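(* Let $m,n\ge 1$ and let $D_0,D_1,D_2$ be complex Hermitian $m\times m$ matrices such that the polynomial $\Delta(x_0,x_1,x_2)=\det(x_0D_0+x_1D_1+x_2D_2)$ is irreducible (of degree $m$). Let $W_n$ be the space of all families $(w_{i})_{i=(i_0,i_1,i_2)\in\mathbb{Z}_{\ge0}^3,\ i_0+i_1+i_2=n-1}$ with $w_i\in\mathbb{C}^m$, and let $$V_n=\{(w_i)\in W_n:\ D_0w_{j_0+1,j_1,j_2}+D_1w_{j_0,j_1+1,j_2}+D_2w_{j_0,j_1,j_2+1}=0\ \text{ for all } j\in\mathbb{Z}_{\ge 0}^3,\ j_0+j_1+j_2=n-2\}.$$ Then $\dim_{\mathbb{C}} V_n=nm$.
   Context: $W_n$ is called the blown space; it has dimension $m\frac{n(n+1)}{2}$. $V_n$ is called the principal subspace. For $n=1$ there are no conditions and $V_1=W_1=\mathbb{C}^m$. *)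

(* Defs.v *)
From HB Require Import structures.
From mathcomp Require Import all_boot all_order all_algebra.
From mathcomp Require Import reals complex mpoly.

Set Implicit Arguments.
Unset Strict Implicit.
Unset Printing Implicit Defensive.

Import GRing.Theory.
Local Open Scope ring_scope.

Definition irreducible_elt (A : comUnitRingType) (p : A) : Prop :=
  [/\ p != 0, p \isn't a GRing.unit
    & forall a b : A, p = a * b -> a \is a GRing.unit \/ b \is a GRing.unit].

Definition determinantal_poly (C : idomainType) (m : nat) (D : 'I_3 -> 'M[C]_m) :
    {mpoly C[3]} :=
  \det (\sum_(k < 3) 'X_k *: map_mx (@mpolyC 3 C) (D k)).

(* For s > 0, the multi-indices i in N^3 with |i| = n - s, none if n < s.  The
   equation is additive because truncated subtraction would wrongly produce
   the index 0 for n = 1, s = 2.  The bound |i| < n, which the equation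
   implies, only serves to make the type finite. *)
Definition multi_index (n s : nat) :=
  {i : 'X_{1..3 < n} | (mdeg i + s == n)%N}.

Section Shift.
Variables (n : nat) (j : multi_index n 2) (k : 'I_3).

Lemma shift_degree : (mdeg (val j + U_(k))%MM + 1 = n)%N.
Proof. by rewrite mdegD mdeg1 -addnA; apply/eqP/(valP j). Qed.

Lemma shift_bound : (mdeg (val j + U_(k))%MM < n)%N.
Proof. by rewrite -[X in (_ < X)%N]shift_degree addn1. Qed.

Lemma shift_subproof : (mdeg (BMultinom shift_bound) + 1 == n)%N.
Proof. by apply/eqP/shift_degree. Qed.

(* j + e_k *)
Definition shift : multi_index n 1 := Sub (BMultinom shift_bound) shift_subproof.
End Shift.

Section Blowup.
Variables (C : fieldType) (m n : nat) (D : 'I_3 -> 'M[C]_m).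

Definition blown_space : vectType C := {ffun multi_index n 1 -> 'cV[C]_m}.

Definition principal_eqn (j : multi_index n 2) (w : blown_space) : 'cV[C]_m :=
  \sum_(k < 3) D k *m (w : {ffun _ -> _}) (shift j k).

Lemma principal_eqn_is_linear j : linear (principal_eqn j).
Proof.
move=> a u v; rewrite /principal_eqn scaler_sumr -big_split /=.
by apply: eq_bigr => k _; rewrite !ffunE mulmxDr scalemxAr.
Qed.

HB.instance Definition _ j :=
  GRing.isLinear.Build C blown_space 'cV[C]_m _ (principal_eqn j)
    (principal_eqn_is_linear j).

Definition principal_subspace : {vspace blown_space} :=
  (\bigcap_(j : multi_index n 2) lker (linfun (principal_eqn j)))%VS.

Lemma mem_principal_subspace (w : blown_space) :
  reflect (forall j, principal_eqn j w = 0) (w \in principal_subspace).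
Proof.
apply: (iffP idP) => [|w0].
  by move=> /[swap] j /subv_bigcapP/(_ j isT); rewrite -memvE memv_ker lfunE => /eqP.
by apply/subv_bigcapP => j _; rewrite -memvE memv_ker lfunE /= w0.
Qed.
End Blowup.

(* Main.v *)
Require Import Defs.
From HB Require Import structures.
From mathcomp Require Import all_boot all_order all_algebra.
From mathcomp Require Import reals complex mpoly.
Local Open Scope ring_scope.

(* The dimension of V_n is dim W_n minus the rank of the system of equations,
   and #{|i| = n - 1} - #{|j| = n - 2} = n, so it suffices that the equations
   are independent.  A linear relation between them is a family of row vectors
   (u_j) with |j| = n - 2 and sum_k u_(i - e_k) D_k = 0 for all i; in terms of
   the vector of polynomials U = sum_j u_j x^j this reads
   U (x_0 D_0 + x_1 D_1 + x_2 D_2) = 0, which forces U = 0 because the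
   determinant is not the zero polynomial. *)

Set Implicit Arguments.
Unset Strict Implicit.
Unset Printing Implicit Defensive.

Import GRing.Theory VectorInternalTheory.

(** Each coordinate of [v - projv (limg f) v] is a functional of [v] that kills the image. By
    hypothesis all of them vanish, so [v] equals its projection. *)
Lemma limg_fullv (K : fieldType) (aT rT : vectType K) (f : 'Hom(aT, rT)) :
  (forall phi : {scalar rT}, (forall w, phi (f w) = 0) -> phi =1 \0) ->
  limg f = fullv.
Proof.
move=> phi0; apply/eqP; rewrite eqEsubv subvf; apply/subvP => v _.
suff /eqP : v - projv (limg f) v = 0.
  by rewrite subr_eq0 => /eqP ->; apply: memv_proj.
apply: v2r_inj; rewrite linear0; apply/rowP => i; rewrite [RHS]mxE.
pose g v : K := v2r (v - projv (limg f) v) 0 i.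
have g_lin : scalar g.
  move=> a u w; rewrite /g linearP opprD addrACA -scalerN -scalerDr.
  by rewrite linearP !mxE.
pose gL := GRing.isLinear.Build _ _ _ _ g g_lin.
pose phi : {scalar rT} := HB.pack g gL.
apply: (phi0 phi) => w /=.
by rewrite /g projv_id ?memv_img ?memvf// subrr linear0 mxE.
Qed.

(** These indices are the exponents of the monomials of degree [d] in three variables; [0 < s] puts
    degree [d] below the bound [d + s] of the finite type. *)
Lemma card_multi_index (d s : nat) :
  (0 < s)%N -> #|{: multi_index (d + s) s}| = 'C(d + 2, 2).
Proof.
move=> s_gt0; have := size_basis 2 d.
rewrite -bin_sub ?leq_addr// addKn => <-.
rewrite cardE -(size_map (fun i : multi_index (d + s) s => bmnm (val i))).
apply/perm_size/uniq_perm; rewrite ?uniq_basis//.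
  by rewrite map_inj_uniq ?enum_uniq// => i j /val_inj/val_inj.
move=> i; rewrite -basis_cover; apply/mapP/eqP => [[j _ ->]|di].
  by have := valP j; rewrite eqn_add2r => /eqP.
have ltid : (mdeg i < d + s)%N by rewrite di -[X in (X < _)%N]addn0 ltn_add2l.
have eqid : (mdeg (BMultinom ltid) + s == d + s)%N by rewrite /= di.
by exists (Sub (BMultinom ltid) eqid); rewrite ?mem_enum// SubK.
Qed.

Lemma card_multi_index12 (n : nat) :
  (0 < n)%N -> #|{: multi_index n 1}| = (n + #|{: multi_index n 2}|)%N.
Proof.
case: n => [//|[|d]] _.
  (* For n = 1 there is no [j] and exactly one [i]; for larger n the difference of the two counts
     comes from Pascal's rule. *)
  rewrite (@card_multi_index 0 1)// eq_card0// => j.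
  by have := valP j; rewrite addn2 eqSS.
have := @card_multi_index d.+1 1 isT; have := @card_multi_index d 2 isT.
by rewrite addn1 addn2 => -> ->; rewrite addSn addn2 binS bin1 addnC.
Qed.

Section EquationMap.
Variables (C : fieldType) (m n : nat) (D : 'I_3 -> 'M[C]_m).

Definition principal_map (w : blown_space C m n) :
    {ffun multi_index n 2 -> 'cV[C]_m} :=
  [ffun j => principal_eqn D j w].

Lemma principal_map_is_linear : linear principal_map.
Proof. by move=> a u v; apply/ffunP => j; rewrite !ffunE linearP. Qed.

HB.instance Definition _ :=
  GRing.isLinear.Build C (blown_space C m n) {ffun multi_index n 2 -> 'cV[C]_m}
    _ principal_map principal_map_is_linear.

Lemma principal_subspaceE : principal_subspace n D = lker (linfun principal_map).
Proof.
apply/vspaceP => w; apply/mem_principal_subspace/idP => [w0|].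
  by rewrite memv_ker lfunE; apply/eqP/ffunP => j; rewrite !ffunE w0.
rewrite memv_ker lfunE => /eqP/ffunP w0 j.
by have := w0 j; rewrite !ffunE.
Qed.

Definition ffun_delta (I : finType) (i : I) (a : 'I_m) : {ffun I -> 'cV[C]_m} :=
  [ffun i' => if i' == i then delta_mx a 0 else 0].

Lemma ffun_sum_delta (I : finType) (v : {ffun I -> 'cV[C]_m}) :
  v = \sum_i \sum_a v i a 0 *: ffun_delta i a.
Proof.
apply/ffunP => i; rewrite sum_ffunE (bigD1 i)//= [X in _ + X]big1 ?addr0.
  rewrite sum_ffunE [LHS]matrix_sum_delta; apply: eq_bigr => a _.
  by rewrite big_ord1 !ffunE eqxx.
move=> i' /negPf ne; rewrite sum_ffunE big1// => a _.
by rewrite !ffunE eq_sym ne scaler0.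
Qed.

(** This is the matrix of the system in the standard bases; it turns the vanishing of a functional
    on the image into scalar relations indexed by [i] and [a]. *)
Lemma principal_map_delta i a :
  principal_map (ffun_delta i a) =
  \sum_j \sum_b (\sum_(k | shift j k == i) D k b a) *: ffun_delta j b.
Proof.
rewrite [LHS]ffun_sum_delta; apply: eq_bigr => j _; apply: eq_bigr => b _.
congr (_ *: _); rewrite ffunE /principal_eqn summxE [RHS]big_mkcond.
apply: eq_bigr => k _; rewrite ffunE; case: ifP => _.
  by rewrite -colE mxE.
by rewrite mulmx0 mxE.
Qed.

Lemma principal_map_annihilator_eq0 (phi : {scalar {ffun multi_index n 2 -> 'cV[C]_m}}) :
  determinantal_poly D != 0 -> (forall w, phi (principal_map w) = 0) ->
  phi =1 \0.
Proof.
move=> detD phi0 v; pose u j b : C := phi (ffun_delta j b).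
suff u0 j b : u j b = 0.
  rewrite [v]ffun_sum_delta linear_sum big1// => j _.
  by rewrite linear_sum big1// => b _; rewrite linearZ /= -/(u j b) u0 mulr0.
pose U : 'rV[{mpoly C[3]}]_m :=
  \row_b \sum_j u j b *: 'X_[bmnm (val j)].
have Ucoef : (U 0 b)@_(bmnm (val j)) = u j b.
  rewrite mxE linear_sum /= (bigD1 j)//= mcoeffZ mcoeffX eqxx mulr1.
  rewrite big1 ?addr0// => j' /negPf ne.
  by rewrite mcoeffZ mcoeffX !(inj_eq val_inj) ne mulr0.
suff U0 : U = 0 by rewrite -Ucoef U0 mxE mcoeff0.
apply/eqP/negPn/negP => U_neq0; case/negP: detD.
(* Polynomials form an integral domain, so a nonzero left kernel vector forces the determinant to
   vanish. *)
apply/det0P; exists U => //; apply/rowP => a; rewrite [RHS]mxE.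
apply/mpolyP => i; rewrite mcoeff0.
have -> : ((U *m \sum_(k < 3) 'X_k *: map_mx (@mpolyC 3 C) (D k)) 0 a)@_i =
    \sum_j \sum_b (\sum_(k | (bmnm (val j) + U_(k))%MM == i) D k b a) * u j b.
  rewrite exchange_big mxE linear_sum; apply: eq_bigr => b' _.
  rewrite mxE mulr_suml linear_sum; apply: eq_bigr => j' _.
  rewrite summxE mulr_sumr linear_sum /= [in RHS]big_mkcond mulr_suml.
  apply: eq_bigr => k _; rewrite !mxE -scalerAl mulrA -mpolyXD mulrC.
  rewrite mul_mpolyC !mcoeffZ mcoeffX.
  by rewrite mulrC; case: eqP => _; rewrite ?(mulr1, mulr0).
(* If the degree of [i] is not n - 1, no [j + e_k] equals [i] and the sum is empty. *)
have [di|di] := eqVneq (mdeg i + 1)%N n; last first.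
  rewrite big1// => j' _; rewrite big1// => b' _; rewrite big1 ?mul0r//.
  by move=> k /eqP ji; case/eqP: di; rewrite -ji shift_degree.
have ltin : (mdeg i < n)%N by rewrite -[X in (_ < X)%N]di addn1.
have eqin : (mdeg (BMultinom ltin) + 1 == n)%N by apply/eqP.
pose i' : multi_index n 1 := Sub (BMultinom ltin) eqin.
(* In degree n - 1, the coefficient at [i] is the value of [phi] on the image of a basis vector of
   the blown space. *)
rewrite -[RHS](phi0 (ffun_delta i' a)) principal_map_delta linear_sum.
apply: eq_bigr => j' _; rewrite linear_sum; apply: eq_bigr => b' _.
by rewrite linearZ.
Qed.

Lemma dim_principal_subspace :
  (0 < n)%N -> determinantal_poly D != 0 ->
  \dim (principal_subspace n D) = (n * m)%N.
Proof.
move=> n_gt0 detD; rewrite principal_subspaceE.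
have := limg_ker_dim (linfun principal_map) fullv.
rewrite capfv limg_fullv => [|phi phi0]; last first.
  by apply: principal_map_annihilator_eq0 => // w; have := phi0 w; rewrite lfunE.
have dimE (I : finType) : dim {ffun I -> 'cV[C]_m} = (#|I| * m)%N.
  by rewrite -[m in RHS]muln1.
(* Rank-nullity: the kernel dimension plus m for each [j] equals m for each [i], and the surplus of
   indices is n. *)
rewrite !dimvf !dimE card_multi_index12// mulnDl => /eqP.
by rewrite eqn_add2r => /eqP.
Qed.

End EquationMap.

Theorem theorem2p1 (R : realType) (m n : nat) (hm : (0 < m)%N) (hn : (0 < n)%N)
    (D : 'I_3 -> 'M[R[i]]_m)
    (hD : forall k : 'I_3, D k \is hermsymmx)
    (hirr : irreducible_elt (determinantal_poly D)) :
  \dim (principal_subspace n D) = (n * m)%N.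
Proof. by have [detD _ _] := hirr; apply: dim_principal_subspace. Qed.
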